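(* Let $\hat n,\hat m\in S^2$ be arbitrary vectors with $\delta=d(\hat m,\hat n)=\arccos\hat m^{\mathrm T}\hat n\in(0,\pi]$. Then for any $k\in\mathbb N$ and any $\phi_1,\dots,\phi_{2k}\in\mathbb R$ the following inequalities hold: $$d\big(\hat R_{\hat m}(\phi_{2k-1})\hat R_{\hat n}(\phi_{2k-2})\cdots\hat R_{\hat m}(\phi_3)\hat R_{\hat n}(\phi_2)\hat R_{\hat m}(\phi_1)\hat m,\ \hat m\big)\le 2(k-1)\delta,$$ $$d\big(\hat R_{\hat m}(\phi_{2k-1})\hat R_{\hat n}(\phi_{2k-2})\cdots\hat R_{\hat m}(\phi_3)\hat R_{\hat n}(\phi_2)\hat R_{\hat m}(\phi_1)\hat m,\ \hat n\big)\le (2k-1)\delta,$$ $$d\big(\hat R_{\hat n}(\phi_{2k})\hat R_{\hat m}(\phi_{2k-1})\cdots\hat R_{\hat m}(\phi_3)\hat R_{\hat n}(\phi_2)\hat R_{\hat m}(\phi_1)\hat m,\ \hat n\big)\le (2k-1)\delta,$$ $$d\big(\hat R_{\hat n}(\phi_{2k})\hat R_{\hat m}(\phi_{2k-1})\cdots\hat R_{\hat m}(\phi_3)\hat R_{\hat n}(\phi_2)\hat R_{\hat m}(\phi_1)\hat m,\ \hat m\big)\le 2k\delta.$$ Here each product is alternating: factors with odd index are rotations about $\hat m$ and factors with even index are rotations about $\hat n$.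
   Context: $\mathbb N$ is the set of strictly positive integers; $S^2=\{\hat v\in\mathbb R^3:\|\hat v\|=1\}$; $d(\hat u,\hat v)=\arccos\hat u^{\mathrm T}\hat v\in[0,\pi]$ is the geodesic metric on $S^2$. $I$ is the $2\times2$ identity matrix and $X=\begin{pmatrix}0&1\\1&0\end{pmatrix}$, $Y=\begin{pmatrix}0&-i\\i&0\end{pmatrix}$, $Z=\begin{pmatrix}1&0\\0&-1\end{pmatrix}$. For $\hat v=(v_x,v_y,v_z)^{\mathrm T}\in S^2$ and $\theta\in\mathbb R$, $R_{\hat v}(\theta)=(\cos\tfrac\theta2)I-i(\sin\tfrac\theta2)(v_xX+v_yY+v_zZ)\in \mathrm{SU}(2)$. $F:\mathrm{SU}(2)\to\mathrm{SO}(3)$ is the surjective homomorphism for which $F(U)(x,y,z)^{\mathrm T}=(x',y',z')^{\mathrm T}$, where $U(xX+yY+zZ)U^\dagger=x'X+y'Y+z'Z$, and $\hat R_{\hat v}(\theta)=F(R_{\hat v}(\theta))$ (the rotation of $\mathbb R^3$ about $\hat v$ by angle $\theta$). *)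

(* Defs.v *)
From mathcomp Require Import all_boot all_order all_algebra.
From mathcomp Require Import all_classical all_reals all_analysis.
From mathcomp.real_closed Require Export complex.
From mathcomp Require Import ring.

Set Implicit Arguments.
Unset Strict Implicit.
Unset Printing Implicit Defensive.

Import Order.TTheory GRing.Theory Num.Theory.

Local Open Scope classical_set_scope.
Local Open Scope ring_scope.
Local Open Scope complex_scope.
Local Open Scope sesquilinear_scope.

Section Defs.
Context {R : realType}.
Implicit Types (u v : 'cV[R]_3) (U H : 'M[R[i]]_2).

Definition dot u v : R := (u^T *m v) 0 0.

(* The Euclidean norm, not the sup norm that the library puts on matrices. *)
Definition enorm v : R := Num.sqrt (dot v v).

Definition S2 : set 'cV[R]_3 := [set v | enorm v = 1].

Definition gdist u v : R := acos (dot u v).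

Definition mx22 (a b c d : R[i]) : 'M[R[i]]_2 :=
  \matrix_(i, j) nth 0 (nth [::] [:: [:: a; b]; [:: c; d]] i) j.

Definition pauliX : 'M[R[i]]_2 := mx22 0 1 1 0.
Definition pauliY : 'M[R[i]]_2 := mx22 0 (- 'i) 'i 0.
Definition pauliZ : 'M[R[i]]_2 := mx22 1 0 0 (- 1).

(* v_x X + v_y Y + v_z Z, coordinates being indexed from 0. *)
Definition pauli v : 'M[R[i]]_2 :=
  (v 0 0)%:C *: pauliX + (v 1 0)%:C *: pauliY
  + (v 2 0)%:C *: pauliZ.

(* The coordinates (x, y, z) of a traceless Hermitian matrix
   x X + y Y + z Z = [[z, x - iy], [x + iy, -z]]; see pauliK, pauli_coordK. *)
Definition pauli_coord H : 'cV[R]_3 :=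
  \col_i [:: complex.Re (H 1 0); complex.Im (H 1 0);
             complex.Re (H 0 0)]`_i.

Definition SU2 : set 'M[R[i]]_2 := [set U | U \is unitarymx /\ \det U = 1].

Definition rotU v (theta : R) : 'M[R[i]]_2 :=
  (cos (theta / 2))%:C *: 1%:M - ('i * (sin (theta / 2))%:C) *: pauli v.

(* The homomorphism F : SU(2) -> SO(3), as a matrix acting on column vectors:
   its j-th column holds the coordinates of U (pauli e_j) U^dagger.  It is a
   total function, used only on SU(2), where it satisfies the defining
   property toSO3P. *)
Definition toSO3 U : 'M[R]_3 :=
  \matrix_(i, j) pauli_coord (U *m pauli (delta_mx j 0) *m U ^t*) i 0.

Definition rot v (theta : R) : 'M[R]_3 := toSO3 (rotU v theta).

(* Rhat_?(phi_j) ... Rhat_n(phi_2) Rhat_m(phi_1): j factors, axis m at odd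
   indices and n at even ones; phi 0 is not used. *)
Fixpoint altrot (m n : 'cV[R]_3) (phi : nat -> R) (j : nat) : 'M[R]_3 :=
  if j is j'.+1 then
    rot (if odd j then m else n) (phi j) *m altrot m n phi j'
  else 1%:M.

End Defs.

Section Facts.
Context {R : realType}.
Implicit Types (u v : 'cV[R]_3) (U H : 'M[R[i]]_2).

Let o2 (i : 'I_2) : i = 0 \/ i = 1.
Proof. by case: i => -[|[|//]] p; [left|right]; apply/val_inj. Qed.

Let o3 (i : 'I_3) : [\/ i = 0, i = 1 | i = 2].
Proof.
by case: i => -[|[|[|//]]] p; [apply: Or31|apply: Or32|apply: Or33];
  apply/val_inj.
Qed.

Lemma pauliE v : pauli v =
  mx22 (v 2 0)%:C
       (v 0 0 -i* v 1 0)
       (v 0 0 +i* v 1 0)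
       (- (v 2 0)%:C).
Proof.
apply/matrixP => i j; rewrite /pauli /pauliX /pauliY /pauliZ /mx22.
by case: (o2 i) => ->; case: (o2 j) => ->; rewrite !mxE /=;
  apply/eqP; rewrite eq_complex /=; simpc; rewrite /= ?eqxx.
Qed.

Lemma pauliK : cancel pauli (@pauli_coord R).
Proof.
move=> v; apply/matrixP => i j; rewrite (ord1 j) pauliE mxE.
by case: (o3 i) => ->; rewrite !mxE .
Qed.

Lemma pauli_coordK H : H ^t* = H -> \tr H = 0 -> pauli (pauli_coord H) = H.
Proof.
move=> /matrixP hH; rewrite /mxtrace !big_ord_recl big_ord0 addr0 => tH.
have := hH 1 1; have := hH 0 0.
have := hH 0 1.
have E0 : ord0 = 0 :> 'I_2 by apply/val_inj.
have E1 : lift ord0 0 = 1 :> 'I_2 by apply/val_inj.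
move: tH; rewrite E0 E1 !mxE pauliE => tH h01 h00 h11.
apply/matrixP => i j.
case: (o2 i) => ->; case: (o2 j) => ->; rewrite !mxE /= .
- move: h00; case: (H _ _) => a b /= [/esym hb]; congr (_ +i* _).
  by move/eqP: hb; rewrite -addr_eq0 -mulr2n mulrn_eq0 /= => /eqP.
- by rewrite -h01; case: (H _ _).
- by case: (H _ _).
- move: h00 tH; case: (H 0 0) => a b /= [/esym hb] /eqP.
  rewrite addrC addr_eq0 => /eqP ->.
  move/eqP: hb; rewrite -addr_eq0 -mulr2n mulrn_eq0 /= => /eqP ->.
  by [].
Qed.

Lemma pauliH v : (pauli v) ^t* = pauli v.
Proof.
apply/matrixP => i j; rewrite pauliE.
by case: (o2 i) => ->; case: (o2 j) => ->; rewrite !mxE /=;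
  apply/eqP; rewrite eq_complex /= ?opprK ?oppr0 ?eqxx.
Qed.

Lemma pauli_tr v : \tr (pauli v) = 0.
Proof.
rewrite pauliE /mxtrace !big_ord_recl big_ord0 addr0 !mxE /=.
by rewrite subrr.
Qed.

Lemma toSO3E U v : toSO3 U *m v = pauli_coord (U *m pauli v *m U ^t*).
Proof.
have -> : pauli v = \sum_j (v j 0)%:C *: pauli (delta_mx j 0).
  apply/matrixP => i j; rewrite summxE.
  rewrite !big_ord_recl big_ord0 addr0 !pauliE.
  have E0 : ord0 = 0 :> 'I_3 by apply/val_inj.
  have E1 : lift ord0 0 = 1 :> 'I_3.
    by apply/val_inj.
  have E2 : lift ord0 (lift ord0 0) = 2 :> 'I_3.
    by apply/val_inj.
  rewrite E2 E1 E0.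
  by case: (o2 i) => ->; case: (o2 j) => ->;
    rewrite !mxE /=;
    apply/eqP; rewrite eq_complex /=; simpc;
    rewrite /= ?(mulr0, mulr1, addr0, add0r, oppr0, subr0, mulrN) ?eqxx.
apply/matrixP => i j; rewrite (ord1 j) mulmx_sumr mulmx_suml.
rewrite [LHS]mxE [RHS]mxE.
have UE a b : (\sum_k U *m ((v k 0)%:C *: pauli (delta_mx k 0)) *m U ^t*) a b
   = \sum_k (v k 0)%:C * (U *m pauli (delta_mx k 0) *m U ^t*) a b.
  by rewrite summxE; apply: eq_bigr => k _; rewrite -scalemxAr -scalemxAl mxE.
have ReS (G : 'I_3 -> R[i]) :
    complex.Re (\sum_k G k) = \sum_k complex.Re (G k).
  by apply: (big_morph _ _ (erefl : complex.Re 0 = 0)) => -[a b] [c d].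
have ImS (G : 'I_3 -> R[i]) :
    complex.Im (\sum_k G k) = \sum_k complex.Im (G k).
  by apply: (big_morph _ _ (erefl : complex.Im 0 = 0)) => -[a b] [c d].
by case: (o3 i) => ->; rewrite /= UE ?ReS ?ImS; apply: eq_bigr => k _;
  rewrite [toSO3 _ _ _]mxE [pauli_coord _ _ _]mxE /=;
  case: (fun_of_matrix _ _ _) => a b /=; simpc; rewrite /= mulrC.
Qed.

Lemma toSO3P U v : U \in SU2 ->
  pauli (toSO3 U *m v) = U *m pauli v *m U ^t*.
Proof.
rewrite inE => -[/unitarymxP UU _]; rewrite toSO3E pauli_coordK //.
  by rewrite !(trmx_mul, map_mxM) /= trmxCK pauliH mulmxA.
by rewrite mxtrace_mulC mulmxA (mulmx1C UU) mul1mx pauli_tr.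
Qed.

Lemma rotU_SU2 v theta : v \in S2 -> rotU v theta \in SU2.
Proof.
rewrite !inE /S2 /enorm /= => v1; have {v1} : dot v v = 1.
  have d0 : 0 <= dot v v.
    by rewrite /dot mxE sumr_ge0 // => i _; rewrite mxE -expr2 sqr_ge0.
  by rewrite -(sqr_sqrtr d0) v1 expr1n.
have E1 : lift ord0 0 = 1 :> 'I_3 by apply/val_inj.
have E2 : lift ord0 (lift ord0 0) = 2 :> 'I_3 by apply/val_inj.
rewrite /dot mxE !big_ord_recl big_ord0 addr0 E2 E1 !mxE => v1.
have := cos2Dsin2 (theta / 2); rewrite /rotU pauliE.
set c := cos _; set s := sin _ => cs.
move: v1; set x := v 0 0; set y := v 1 0; set z := v 2 0 => v1.
have -> : c%:C *: 1%:M - ('i * s%:C) *: mx22 z%:C (x -i* y) (x +i* y) (- z%:C)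
  = mx22 (c -i* (s * z)) ((- (s * y)) -i* (s * x))
         ((s * y) -i* (s * x)) (c +i* (s * z)).
  apply/matrixP => i j.
  by case: (o2 i) => ->; case: (o2 j) => ->; rewrite !mxE /=;
    apply/eqP; rewrite eq_complex /=; simpc; apply/andP; split=> //;
    apply/eqP; ring.
have F1 : lift ord0 0 = 1 :> 'I_2 by apply/val_inj.
have K : c ^+ 2 + s ^+ 2 * (x * x + (y * y + z * z)) = 1 by rewrite v1 mulr1.
split.
- apply/unitarymxP/matrixP => i j.
  by case: (o2 i) => ->; case: (o2 j) => ->;
    rewrite !mxE !big_ord_recl big_ord0 addr0 F1 !mxE /=;
    apply/eqP; rewrite eq_complex /=; simpc; apply/andP; split=> //; apply/eqP;
    rewrite -?K; ring.
- rewrite (expand_det_row _ 0) !big_ord_recl big_ord0 addr0 /cofactor !det_mx11.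
  rewrite F1 !mxE /= expr0 expr1 mul1r.
  by apply/eqP; rewrite eq_complex /=; simpc; apply/andP; split=> //; apply/eqP;
    rewrite -?K; ring.
Qed.

End Facts.

(* Main.v *)
(* Rotations preserve the geodesic metric and fix their axis, so rotating about
   m (resp. n) leaves the distance to m (resp. n) unchanged, while the triangle
   inequality on the sphere bounds by delta the change in distance when the
   reference point moves from m to n or back. *)
Require Import Defs.
From mathcomp Require Import all_boot all_order all_algebra.
From mathcomp Require Import all_classical all_reals all_analysis.
From mathcomp Require Import ring lra.

Import Order.TTheory GRing.Theory Num.Theory.
Local Open Scope classical_set_scope.
Local Open Scope ring_scope.

Section Sphere.
Context {R : realType}.
Implicit Types (u v w : 'cV[R]_3) (U : 'M[R[i]%C]_2).
Local Open Scope sesquilinear_scope.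
Local Open Scope complex_scope.

Lemma dotE u v :
  dot u v = u 0 0 * v 0 0 + u 1 0 * v 1 0 + u 2 0 * v 2 0.
Proof.
have E1 : lift ord0 0 = 1 :> 'I_3 by apply/val_inj.
have E2 : lift ord0 (lift ord0 0) = 2 :> 'I_3 by apply/val_inj.
by rewrite /dot mxE !big_ord_recl big_ord0 addr0 E2 E1 !mxE addrA.
Qed.

Lemma dotC u v : dot u v = dot v u.
Proof. by rewrite !dotE; ring. Qed.

Lemma S2P v : v \in S2 <-> dot v v = 1.
Proof.
rewrite inE /S2 /enorm /=; split=> [v1|->]; last exact: sqrtr1.
have d0 : 0 <= dot v v by rewrite dotE -!expr2 !addr_ge0 ?sqr_ge0.
by rewrite -(sqr_sqrtr d0) v1 expr1n.
Qed.

(** Both bounds come from expanding the squared norms of [u + v] and [u - v], which equal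
    [2 + 2 * dot u v] and [2 - 2 * dot u v]. *)
Lemma dot_itv u v : u \in S2 -> v \in S2 -> -1 <= dot u v <= 1.
Proof.
move=> /S2P + /S2P; rewrite !dotE => u1 v1.
have p := addr_ge0 (addr_ge0 (sqr_ge0 (u 0 0 + v 0 0))
  (sqr_ge0 (u 1 0 + v 1 0))) (sqr_ge0 (u 2 0 + v 2 0)).
have q := addr_ge0 (addr_ge0 (sqr_ge0 (u 0 0 - v 0 0))
  (sqr_ge0 (u 1 0 - v 1 0))) (sqr_ge0 (u 2 0 - v 2 0)).
by apply/andP; split; lra.
Qed.

(* The left-hand side is a Gram determinant: the square of det [u, v, w]. *)
Lemma gram_ge0 u v w :
  0 <= dot u u * dot v v * dot w w + 2 * (dot u v * dot v w * dot u w)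
       - dot u u * dot v w ^+ 2 - dot v v * dot u w ^+ 2
       - dot w w * dot u v ^+ 2.
Proof.
rewrite !dotE [leRHS](_ : _ =
  (u 0 0 * (v 1 0 * w 2 0 - v 2 0 * w 1 0)
   - u 1 0 * (v 0 0 * w 2 0 - v 2 0 * w 0 0)
   + u 2 0 * (v 0 0 * w 1 0 - v 1 0 * w 0 0)) ^+ 2) ?sqr_ge0 //.
by ring.
Qed.

Lemma gdistC u v : gdist u v = gdist v u.
Proof. by rewrite /gdist dotC. Qed.

(** Rewrites the inner product as a trace, a quantity visibly invariant under conjugation. *)
Lemma mxtrace_pauliM u v : \tr (pauli u *m pauli v) = (2 * dot u v)%:C.
Proof.
have F1 : lift ord0 0 = 1 :> 'I_2 by apply/val_inj.
rewrite /mxtrace !big_ord_recl big_ord0 F1 !mxE !big_ord_recl !big_ord0 F1.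
rewrite !pauliE !mxE /= dotE; apply/eqP; rewrite eq_complex /=; simpc.
by apply/andP; split=> //; apply/eqP; ring.
Qed.

(** [toSO3 U] acts on [pauli] matrices as conjugation by [U]; in the trace of the product the inner
    pair cancels by unitarity, the outer pair by cyclicity. *)
Lemma dot_toSO3 U u v : U \in SU2 ->
  dot (toSO3 U *m u) (toSO3 U *m v) = dot u v.
Proof.
move=> hU; have := hU; rewrite inE => -[/unitarymxP /mulmx1C UU _].
suff /(congr1 (@complex.Re R)) /= :
    (2 * dot (toSO3 U *m u) (toSO3 U *m v))%:C = (2 * dot u v)%:C.
  by apply: mulfI; rewrite pnatr_eq0.
rewrite -!mxtrace_pauliM !toSO3P // -!mulmxA (mulmxA (U ^t*)) UU mul1mx.
by rewrite mxtrace_mulC -!mulmxA UU mulmx1.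
Qed.

(** [rotU v theta] is a linear combination of the identity and [pauli v], so it commutes with
    [pauli v]. *)
Lemma rot_axis v (theta : R) : v \in S2 -> Defs.rot v theta *m v = v.
Proof.
move=> vS; have := rotU_SU2 theta vS.
rewrite inE => -[/unitarymxP UU _].
rewrite /Defs.rot toSO3E.
have -> : rotU v theta *m pauli v = pauli v *m rotU v theta.
  rewrite /rotU mulmxBl mulmxBr -!scalemxAl -!scalemxAr.
  by rewrite mul1mx mulmx1.
by rewrite -mulmxA UU mulmx1 pauliK.
Qed.

Lemma rot_S2 v (theta : R) u : v \in S2 -> u \in S2 ->
  Defs.rot v theta *m u \in S2.
Proof.
by move=> vS /S2P u1; apply/S2P; rewrite dot_toSO3 // rotU_SU2.
Qed.

Lemma gdist_rot_axis v (theta : R) u : v \in S2 ->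
  gdist (Defs.rot v theta *m u) v = gdist u v.
Proof.
by move=> vS; rewrite /gdist -{2}(rot_axis _ theta vS) dot_toSO3 // rotU_SU2.
Qed.

Lemma gdist_triangle u v w : u \in S2 -> v \in S2 -> w \in S2 ->
  gdist u w <= gdist u v + gdist v w.
Proof.
move=> uS vS wS; have := gram_ge0 u v w.
move: (dot_itv _ _ uS vS) (dot_itv _ _ vS wS) (dot_itv _ _ uS wS).
move: uS vS wS => /S2P -> /S2P -> /S2P ->; rewrite /gdist.
set x := dot u v; set y := dot v w; set z := dot u w => xI yI zI gram.
(* If the two angles add up to at least [pi], the bound is trivial; otherwise their sum lies where
   [cos] is decreasing. *)
have [ab|/ltW ab] := leP pi (acos x + acos y).
  exact: le_trans (acos_lepi zI) ab.
have abI : acos x + acos y \in `[0, pi].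
  by rewrite in_itv /= ab addr_ge0 ?acos_ge0.
have zaI : acos z \in `[0, pi] by rewrite in_itv /= acos_ge0 ?acos_lepi.
(* Taking cosines reverses the inequality: it remains to show that [x * y] minus the product of the
   two sines is at most [z]. *)
rewrite leNgt -(ltr_cos abI zaI) -leNgt cosD !sin_acos // !acosK ?in_itv //=.
(* By Gram positivity, (x y - z)^2 <= (1 - x^2)(1 - y^2). *)
rewrite lerBlDr -lerBlDl; apply: le_trans (ler_norm _) _.
have x0 : 0 <= 1 - x ^+ 2 by nra.
have y0 : 0 <= 1 - y ^+ 2 by nra.
by rewrite -sqrtrM // -sqrtr_sqr ler_sqrt ?mulr_ge0 //; lra.
Qed.

Lemma altrot_S2 m n (phi : nat -> R) j :
  m \in S2 -> n \in S2 -> altrot m n phi j *m m \in S2.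
Proof.
move=> mS nS; elim: j => [|j IH] /=; first by rewrite mul1mx.
by rewrite -mulmxA rot_S2 //; case: ifP.
Qed.

Lemma gdist_altrot_axis m n (phi : nat -> R) j : m \in S2 -> n \in S2 ->
  gdist (altrot m n phi j.+1 *m m) (if odd j then n else m) <= j%:R * gdist m n.
Proof.
move=> mS nS; elim: j => [|j IH].
  by rewrite /= mulmx1 gdist_rot_axis // mul0r /gdist (iffLR (S2P m) mS) acos1.
(* [a] is the axis of factor [j.+1], and [b] that of factor [j.+2]. *)
set a := if odd j then n else m in IH; set b := if odd j.+1 then n else m.
have [aS bS] : a \in S2 /\ b \in S2 by rewrite /a /b; split; case: ifP.
have step : gdist a b = gdist m n.
  by rewrite /a /b /=; case: odd; rewrite /= ?[gdist n m]gdistC.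
have -> : altrot m n phi j.+2 =
    Defs.rot b (phi j.+2) *m altrot m n phi j.+1.
  by rewrite /b /=; case: odd.
rewrite -mulmxA gdist_rot_axis // -natr1 mulrDl mul1r.
apply: le_trans (gdist_triangle _ _ _ (altrot_S2 _ _ phi j.+1 mS nS) aS bS) _.
by rewrite step lerD2r.
Qed.

End Sphere.

Theorem lemma4 (R : realType) (n m : 'cV[R]_3) (delta : R)
    (hn : n \in S2) (hm : m \in S2)
    (hdelta : delta = gdist m n) (delta_itv : 0 < delta <= pi)
    (k : nat) (hk : (0 < k)%N) (phi : nat -> R) :
  [/\ gdist (altrot m n phi (2 * k - 1) *m m) m <= 2 * (k%:R - 1) * delta,
      gdist (altrot m n phi (2 * k - 1) *m m) n <= (2 * k%:R - 1) * delta,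
      gdist (altrot m n phi (2 * k) *m m) n <= (2 * k%:R - 1) * delta &
      gdist (altrot m n phi (2 * k) *m m) m <= 2 * k%:R * delta].
Proof.
case: k hk => // k _.
(* With [k.+1] in place of [k], the truncated subtraction is exact and the parity of the number of
   factors is explicit. *)
have -> : (2 * k.+1 - 1 = k.*2.+1)%N by rewrite mul2n.
have -> : (2 * k.+1 = k.*2.+2)%N by rewrite mul2n.
have am : gdist (altrot m n phi k.*2.+1 *m m) m <= k.*2%:R * delta.
  by have := gdist_altrot_axis m n phi k.*2 hm hn; rewrite odd_double hdelta.
have an : gdist (altrot m n phi k.*2.+2 *m m) n <= k.*2.+1%:R * delta.
  by have := gdist_altrot_axis m n phi k.*2.+1 hm hn;
    rewrite oddS odd_double hdelta.
(* The second and fourth bounds refer to the other axis: one more triangle inequality adds a single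
   [delta] to [am] and [an]. *)
have tm := gdist_triangle _ _ _ (altrot_S2 m n phi k.*2.+1 hm hn) hm hn.
have tn := gdist_triangle _ _ _ (altrot_S2 m n phi k.*2.+2 hm hn) hn hm.
move: am an tm tn; rewrite [gdist n m]gdistC -hdelta.
rewrite -!natr1 -mul2n natrM => am an tm tn.
by split; lra.
Qed.
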